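(* Let $v:\{1,\dots,n\}\times[0,1]^n\to[0,1]$ be a monotone user utility function such that $v(j,S)$ does not depend on the entries $S[j']$ with $j'>j$. Let $G$ be the publisher game with user utility function $v$ whose ranking function is the utility-induced ranking (UIR) of $v$, i.e. the ranking with score function $f_v$. Then $G$ has at least one Nash equilibrium, described by the following recursive formula: for $i=1,\dots,n$, $$x_i\in\operatorname*{argmax}_{y\in\mathbb{X}} f_v\big(y,P,(x_{i'})_{i'<i}\big).$$ In addition, if the maximizer of each of these expressions is unique, then the Nash equilibrium of $G$ is unique.
   Context: Let $n,k\ge 1$ be integers, $N=\{1,\dots,n\}$ the set of publishers (players), and $\mathbb{X}=[0,1]^k$ with the Euclidean norm. Each publisher $i$ chooses a document (strategy) $x_i\in\mathbb{X}$; a strategy profile is $x=(x_1,\dots,x_n)\in\mathbb{X}^n$, and $x_{-i}$ denotes the strategies of all publishers other than $i$. The aspect distribution $P$ is a probability distribution (discrete or continuous) over query aspects $a$, each represented by a point $x_a\in\mathbb{X}$; $\mathbb{E}_P$ is expectation over $a$ drawn from $P$. Similarity: $s(x,y)=1-\frac1k\|x-y\|^2\in[0,1]$, and $s_i^a=s(x_i,x_a)$. Ranking: given a score function $f(x_i,P,L)$, where $L$ is the (ordered) list of documents already ranked, positions $j=1,\dots,n$ are filled successively: position $j$ is given to the not-yet-ranked document $l_j$ maximizing $f(x_i,P,L_{j-1})$, where $L_0=\emptyset$ and $L_j$ is $L_{j-1}$ followed by $l_j$. Ties are broken lexicographically (smallest publisher index first). $r_i$ denotes the position of publisher $i$, $l_j$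 the publisher at position $j$, and $S_r^a=(s_{l_1}^a,\dots,s_{l_n}^a)$ the similarity scores to aspect $a$ ordered by the ranking. User utility: $v(j,S_r^a)\in[0,1]$ is the utility a user with aspect $a$ gains from the document at position $j$. $v$ is monotone if for every document tuple $x$, every aspect $a$, every ranking $r$ and every pair $i,i'$ with $r_i>r_{i'}$, switching the positions of documents $i$ and $i'$ (weakly) increases the utility gained from document $i$; i.e. $v(r_{i'},\tilde S)\ge v(r_i,S_r^a)$ where $\tilde S$ is $S_r^a$ with its entries at positions $r_i$ and $r_{i'}$ exchanged. Publisher utility in the publisher game: $u_i(x)=\mathbb{E}_P[v(r_i,S_r^a)]$. UIR score function of $v$: $$f_v(x_i,P,L)=\mathbb{E}_P\big[v\big(|L|+1,\ (s_{i'}^a)_{i'\in L}\,\|\,s_i^a\big)\big],$$ where $\|$ denotes appending an element to the list, and the list has the order of $L$ (the remaining entries of the second argument of $v$ are irrelevant by the independence assumption). In the recursive formula, the list $(x_{i'})_{i'<i}$ is $(x_1,\dots,x_{i-1})$. Nash equilibrium: a profile $x$ such that $u_i(x)\ge u_i(x_i',x_{-i})$ for all $i$ and all $x_i'\in\mathbb{X}$ (pure strategies).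
   Formalization: Existence of the equilibrium is stated assuming each argmax in the recursion is nonempty; without continuity of v it can be empty (n=k=1, v(1,S)=S[1] if S[1]<1, else 0) and no equilibrium exists. The utilities are assumed measurable in the aspect. *)

(* Defs.v *)
From HB Require Import structures.
From mathcomp Require Import all_boot all_order all_algebra all_fingroup.
From mathcomp Require Import all_classical all_reals all_analysis.

Set Implicit Arguments.
Unset Strict Implicit.
Unset Printing Implicit Defensive.
Import Order.TTheory GRing.Theory Num.Theory.
Local Open Scope classical_set_scope.
Local Open Scope ring_scope.

(* There are n.+1 publishers and documents have k.+1 coordinates, so both
   numbers are at least 1. Publishers and ranking positions are both elements
   of 'I_n.+1, counted from 0: position j : 'I_n.+1 is the (j+1)-st position. *)

Section Documents.
Context {R : realType} {k : nat}.
Implicit Types x y : 'rV[R]_k.+1.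

Definition docs : set 'rV[R]_k.+1 := [set x | forall c, 0 <= x 0 c <= 1].

(* The library norm on row vectors is the sup norm, hence this definition. *)
Definition euclidean_norm x : R := Num.sqrt (\sum_c x 0 c ^+ 2).

Definition sim x y : R := 1 - k.+1%:R^-1 * euclidean_norm (x - y) ^+ 2.

Definition argmax (g : 'rV[R]_k.+1 -> \bar R) : set 'rV[R]_k.+1 :=
  [set y | docs y /\ forall z, docs z -> (g z <= g y)%E].

End Documents.

Section Game.
Context {R : realType} {n k : nat}.

Definition profile := {ffun 'I_n.+1 -> 'rV[R]_k.+1}.

Definition is_profile (x : profile) : Prop := forall i, docs (x i).

Definition deviate (x : profile) (i : 'I_n.+1) (y : 'rV[R]_k.+1) : profile :=
  [ffun i' => if i' == i then y else x i'].

(* f y L is the score of the document y once the documents in L are ranked. *)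
Definition score_function := 'rV[R]_k.+1 -> seq 'rV[R]_k.+1 -> \bar R.

(* l lists the publishers ranked so far, in ranking order. *)
Definition next_ranked (f : score_function) (x : profile) (l : seq 'I_n.+1)
    : option 'I_n.+1 :=
  let sc i := f (x i) [seq x i' | i' <- l] in
  [pick i | (i \notin l) &&
    [forall (i' | i' \notin l),
      (sc i' < sc i)%E || ((sc i' == sc i) && (i <= i')%N)]].

Definition rank_next f x l :=
  if next_ranked f x l is Some i then rcons l i else l.

Definition ranking (f : score_function) (x : profile) : seq 'I_n.+1 :=
  iter n.+1 (rank_next f x) [::].

Definition position (f : score_function) (x : profile) (i : 'I_n.+1)
    : 'I_n.+1 :=
  inord (index i (ranking f x)).

Section Aspects.
Context {d : measure_display} {A : measurableType d}.
Variables (P : probability A R) (asp : A -> 'rV[R]_k.+1).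

(* Similarities to aspect a of the documents in L; when L has fewer than n.+1
   documents the remaining entries are filled with 0. *)
Definition sim_vector (L : seq 'rV[R]_k.+1) (a : A) : 'rV[R]_n.+1 :=
  \row_j nth 0 [seq sim y (asp a) | y <- L] j.

(* v j S is only meaningful for S in [0,1]^(n+1). *)
Definition user_utility := 'I_n.+1 -> 'rV[R]_n.+1 -> R.

Definition unit_cube : set 'rV[R]_n.+1 := [set S | forall j, 0 <= S 0 j <= 1].

Definition unit_valued (v : user_utility) : Prop :=
  forall j S, unit_cube S -> 0 <= v j S <= 1.

Definition prefix_dependent (v : user_utility) : Prop :=
  forall (j : 'I_n.+1) S S', unit_cube S -> unit_cube S' ->
    (forall j' : 'I_n.+1, (j' <= j)%N -> S 0 j' = S' 0 j') -> v j S = v j S'.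

(* r maps a publisher to its position. *)
Definition ranked_sim (x : profile) (r : {perm 'I_n.+1}) (a : A)
    : 'rV[R]_n.+1 :=
  \row_j sim (x ((r^-1)%g j)) (asp a).

Definition monotone_utility (v : user_utility) : Prop :=
  forall (x : profile) (a : A) (r : {perm 'I_n.+1}) (i i' : 'I_n.+1),
    is_profile x -> (r i' < r i)%N ->
    v (r i) (ranked_sim x r a) <=
    v (r i') (xcol (r i) (r i') (ranked_sim x r a)).

(* Expectations over the aspects of the user utility are well defined. This
   holds for every v when A is discrete, and for v j Borel when asp is a random
   vector. *)
Definition measurable_utility (v : user_utility) : Prop :=
  forall (j : 'I_n.+1) (x : profile), is_profile x ->
    measurable_fun setT (fun a => v j (\row_j' sim (x j') (asp a))).

Definition publisher_utility (v : user_utility) (f : score_function)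
    (i : 'I_n.+1) (x : profile) : \bar R :=
  ('E_P[fun a => v (position f x i)
                   (sim_vector [seq x i' | i' <- ranking f x] a)])%E.

Definition nash_equilibrium (v : user_utility) (f : score_function)
    (x : profile) : Prop :=
  is_profile x /\
  forall i y, docs y ->
    (publisher_utility v f i (deviate x i y) <= publisher_utility v f i x)%E.

(* Only used for size L <= n; inord (size L) is then the position following
   those of L. *)
Definition uir_score (v : user_utility) : score_function := fun y L =>
  ('E_P[fun a => v (inord (size L)) (sim_vector (rcons L y) a)])%E.

Definition previous_docs (x : profile) (i : 'I_n.+1) : seq 'rV[R]_k.+1 :=
  [seq x i' | i' : 'I_n.+1 <- enum 'I_n.+1 & (i' < i)%N].

Definition best_docs (v : user_utility) (x : profile) (i : 'I_n.+1)
    : set 'rV[R]_k.+1 :=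
  argmax (fun y => uir_score v y (previous_docs x i)).

Definition recursive_below (v : user_utility) (x : profile) (i : 'I_n.+1)
    : Prop :=
  forall i' : 'I_n.+1, (i' < i)%N -> best_docs v x i' (x i').

Definition recursive_profile (v : user_utility) (x : profile) : Prop :=
  forall i, best_docs v x i (x i).

(* Without continuity of v the argmax of the recursion can be empty. *)
Definition maximizers_exist (v : user_utility) : Prop :=
  forall x i, recursive_below v x i -> best_docs v x i !=set0.

Definition maximizers_unique (v : user_utility) : Prop :=
  forall x i, recursive_below v x i -> exists! y, best_docs v x i y.

End Aspects.
End Game.

Arguments profile : clear implicits.
Arguments user_utility : clear implicits.

(* Main.v *)
(** If the documents of the publishers before [i] follow the recursion, then these
    publishers occupy the positions before [i] in order, whatever the others play: at
    each of these positions the recursive document has maximal score among all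
    documents, and ties favour the smaller index. By monotonicity, the utility of
    publisher [i] is then at most the score of its document for position [i], with
    equality when that document maximizes the score. Hence no deviation from a
    recursive profile pays off. Conversely, in an equilibrium, the first publisher
    departing from the recursion could gain by moving to the maximizer, so when
    maximizers are unique every equilibrium is the recursive profile. *)
Require Import Defs.
From HB Require Import structures.
From mathcomp Require Import all_boot all_order all_algebra all_fingroup.
From mathcomp Require Import all_classical all_reals all_analysis.

Set Implicit Arguments.
Unset Strict Implicit.
Unset Printing Implicit Defensive.
Import Order.TTheory GRing.Theory Num.Theory.

Local Open Scope classical_set_scope.
Local Open Scope ring_scope.

(** * Range of the similarity *)

Section Similarity.
Context {R : realType} {k : nat}.
Implicit Types x y : 'rV[R]_k.+1.

Lemma sim_unit x y : docs x -> docs y -> 0 <= sim x y <= 1.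
Proof.
move=> dx dy.
have sum_ge0 : 0 <= \sum_c (x - y) 0 c ^+ 2 by apply: sumr_ge0 => c _; exact: sqr_ge0.
rewrite /sim /euclidean_norm sqr_sqrtr// subr_ge0 gerBl mulr_ge0 ?invr_ge0//.
rewrite ler_pdivrMl// mulr1 andbT.
(* The bound is compared termwise: each squared coordinate difference is at most 1. *)
have -> : k.+1%:R = \sum_(c < k.+1) (1 : R) by rewrite sumr_const card_ord.
apply: ler_sum => c _; rewrite !mxE -real_normK ?num_real// expr_le1//.
have /andP[x0 x1] := dx c; have /andP[y0 y1] := dy c.
by rewrite ler_norml lerBrDr lerBlDr (le_trans _ x0) ?(le_trans x1) ?ler_wpDr ?addNr ?lerDl //
  addrC subr_le0.
Qed.

Lemma nth_sim (L : seq 'rV[R]_k.+1) y j : (j < size L)%N ->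
  nth 0 [seq sim z y | z <- L] j = sim (nth 0 L j) y.
Proof. by move=> jL; rewrite (nth_map 0). Qed.

End Similarity.

Lemma filter_enum_ord_take n i : (i <= n)%N ->
  [seq j : 'I_n <- enum 'I_n | (j < i)%N] = take i (enum 'I_n).
Proof.
move=> ilen; apply: (inj_map val_inj).
rewrite -(filter_map val (fun m => (m < i)%N)) map_take val_enum_ord take_iota (minn_idPl ilen).
by rewrite -[i in LHS]add0n; exact: filter_iota_ltn.
Qed.

(** * The greedy ranking and its prefixes *)

Section Ranking.
Context {R : realType} {n k : nat}.
Variables (f : @score_function R k) (x : profile R n k).
Implicit Types (i j : 'I_n.+1) (l : seq 'I_n.+1) (m : nat).

Let score i l := f (x i) [seq x i' | i' <- l].

(** A weak maximum suffices, since the smallest remaining index wins every tie. *)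
Lemma next_ranked_eq i l : i \notin l ->
  (forall i', i' \notin l -> (score i' l <= score i l)%E) ->
  (forall i', i' \notin l -> (i <= i')%N) ->
  next_ranked f x l = Some i.
Proof.
move=> il imax imin; rewrite /next_ranked; case: pickP => [j|/(_ i)].
  move=> /andP[jl /forall_inP/(_ i il)].
  rewrite ltNge imax// /= => /andP[_ ji].
  by congr Some; apply/val_inj/eqP; rewrite eqn_leq ji imin.
rewrite il => /negbT/negP[]; apply/forall_inP => j jl.
by rewrite imin// andbT orbC -le_eqVlt; exact: imax.
Qed.

(** By counting, someone is unranked; among the unranked of maximal score, the least index passes
    the test. *)
Lemma next_ranked_exists l : (size l < n.+1)%N ->
  exists2 i, next_ranked f x l = Some i & i \notin l.
Proof.
move=> sl; rewrite /next_ranked; case: pickP => [i /andP[il _]|noi]; first by exists i.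
have [i0 i0l] : exists i, i \notin l.
  apply/existsP; rewrite -negb_forall; apply/negP => /forallP all_l.
  have := uniq_leq_size (enum_uniq 'I_n.+1) (fun i _ => all_l i).
  by rewrite size_enum_ord leqNgt sl.
case: (@Order.TotalTheory.arg_maxP _ _ _ i0 [pred i | i \notin l] (score ^~ l) i0l) => i1 /= i1l i1max.
pose best := [pred i | (i \notin l) && (score i l == score i1 l)].
have bi1 : best i1 by rewrite /= i1l eqxx.
case: (@arg_minnP _ i1 best val bi1) => i /andP[il /eqP sci] imin.
have /negP[] := negbT (noi i); rewrite il /=.
apply/forall_inP => j jl; rewrite -/(score j l) -/(score i l) sci.
have := i1max _ jl; rewrite /= le_eqVlt => /orP[/eqP scj|->//].
by rewrite scj eqxx imin ?orbT//= jl scj eqxx.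
Qed.

Definition ranked m := iter m (rank_next f x) [::].

Lemma rankedS m : ranked m.+1 = rank_next f x (ranked m).
Proof. by []. Qed.

Lemma ranked_uniq_size m : (m <= n.+1)%N -> uniq (ranked m) /\ size (ranked m) = m.
Proof.
elim: m => [//|m IH] mn; have [um sm] := IH (ltnW mn).
have [|i nri il] := @next_ranked_exists (ranked m); first by rewrite sm.
by rewrite rankedS /rank_next nri rcons_uniq il um size_rcons sm.
Qed.

(** Each step only appends at the end, so the stages of the construction are prefixes of the
    result. *)
Lemma take_ranking m : (m <= n.+1)%N -> take m (ranking f x) = ranked m.
Proof.
move=> mn; have [_ sm] := ranked_uniq_size mn.
suff: prefix (ranked m) (ranking f x) by rewrite prefixE sm => /eqP.
have <- : ranked (m + (n.+1 - m)) = ranking f x by rewrite subnKC.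
elim: (n.+1 - m)%N => [|p IH]; first by rewrite addn0 prefix_refl.
rewrite addnS rankedS /rank_next; case: next_ranked => [i|//].
exact: prefix_trans IH (prefix_rcons _ _).
Qed.

Lemma size_ranking : size (ranking f x) = n.+1.
Proof. by have [] := ranked_uniq_size (leqnn n.+1). Qed.

Lemma uniq_ranking : uniq (ranking f x).
Proof. by have [] := ranked_uniq_size (leqnn n.+1). Qed.

Lemma mem_ranking i : i \in ranking f x.
Proof.
have [|_ ->] := uniq_min_size uniq_ranking (fun j _ => mem_enum 'I_n.+1 j).
  by rewrite size_ranking size_enum_ord.
by rewrite mem_enum.
Qed.

Lemma positionE i : position f x i = index i (ranking f x) :> nat.
Proof. by rewrite /position inordK// -[X in (_ < X)%N]size_ranking index_mem mem_ranking. Qed.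

Lemma position_nth j : position f x (nth ord0 (ranking f x) j) = j.
Proof. by apply/val_inj; rewrite /= positionE index_uniq ?size_ranking ?uniq_ranking. Qed.

Lemma nth_position i : nth ord0 (ranking f x) (position f x i) = i.
Proof. by rewrite positionE nth_index// mem_ranking. Qed.

Lemma position_inj : injective (position f x).
Proof. by apply: (can_inj (g := fun j => nth ord0 (ranking f x) j)); exact: nth_position. Qed.

(** The form in which [monotone_utility] takes a ranking. *)
Definition position_perm : {perm 'I_n.+1} := perm position_inj.

Lemma position_permV j : (position_perm^-1)%g j = nth ord0 (ranking f x) j.
Proof. by apply: (canLR (permK _)); rewrite permE position_nth. Qed.

(** Once the publishers before [m] are ranked in order, publisher [m] has maximal score and the
    smallest remaining index. *)
Lemma ranked_prefix m : (m <= n.+1)%N ->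
  (forall i, (i < m)%N -> forall j,
    (score j (take i (enum 'I_n.+1)) <= score i (take i (enum 'I_n.+1)))%E) ->
  ranked m = take m (enum 'I_n.+1).
Proof.
elim: m => [|m IH] mn best; first by rewrite take0.
rewrite rankedS IH; [|exact: ltnW|by move=> i im; apply: best; exact: ltnW].
pose i : 'I_n.+1 := Ordinal mn.
have memt j : (j \in take m (enum 'I_n.+1)) = (j < m)%N.
  by rewrite -filter_enum_ord_take ?(ltnW mn)// mem_filter mem_enum andbT.
rewrite /rank_next (@next_ranked_eq i).
- by rewrite (take_nth ord0) ?size_enum_ord//; congr rcons; rewrite (nth_ord_enum ord0 i).
- by rewrite memt ltnn.
- by move=> j _; exact: (best i).
- by move=> j; rewrite memt -leqNgt.
Qed.

End Ranking.

(** * Recursive profiles and their ranking *)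

Section Game.
Context {R : realType} {n k : nat}.
Context {d : measure_display} {A : measurableType d}.
Variables (P : probability A R) (asp : A -> 'rV[R]_k.+1) (v : user_utility R n).
Implicit Types (x : profile R n k) (i q : 'I_n.+1) (y : 'rV[R]_k.+1).

Lemma previous_docsE x i :
  previous_docs x i = [seq x i' | i' <- take i (enum 'I_n.+1)].
Proof. by rewrite /previous_docs filter_enum_ord_take// ltnW. Qed.

Lemma eq_previous_docs x x' i : (forall i' : 'I_n.+1, (i' < i)%N -> x i' = x' i') ->
  previous_docs x i = previous_docs x' i.
Proof. by move=> xx'; apply/eq_in_map => i'; rewrite mem_filter => /andP[/xx']. Qed.

Lemma eq_best_docs x x' i : (forall i' : 'I_n.+1, (i' < i)%N -> x i' = x' i') ->
  best_docs P asp v x i = best_docs P asp v x' i.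
Proof. by move=> xx'; rewrite /best_docs (eq_previous_docs xx'). Qed.

Lemma deviate_id x i y : deviate x i y i = y.
Proof. by rewrite ffunE eqxx. Qed.

Lemma deviate_lt x i y i' : (i' < i)%N -> deviate x i y i' = x i'.
Proof. by move=> i'i; rewrite ffunE; case: eqP i'i => // ->; rewrite ltnn. Qed.

Lemma deviate_profile x i y : is_profile x -> docs y -> is_profile (deviate x i y).
Proof. by move=> dx dy i'; rewrite ffunE; case: eqP. Qed.

(** The argmax set at [i'] depends only on documents strictly before [i'], so the case [i' = i] is
    included. *)
Lemma best_docs_deviate x i y i' : (i' <= i)%N ->
  best_docs P asp v (deviate x i y) i' = best_docs P asp v x i'.
Proof. by move=> i'i; apply: eq_best_docs => j ji'; rewrite deviate_lt ?(leq_trans ji'). Qed.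

Lemma deviate_recursive x i y :
  recursive_below P asp v x i -> recursive_below P asp v (deviate x i y) i.
Proof. by move=> rx i' i'i; rewrite best_docs_deviate ?(ltnW i'i)// deviate_lt//; exact: rx. Qed.

Lemma recursive_is_profile x : recursive_profile P asp v x -> is_profile x.
Proof. by move=> rx i; have [] := rx i. Qed.

(** Maximizers are inserted one publisher at a time into an arbitrary profile; each insertion
    preserves the earlier argmax sets. *)
Lemma recursive_exists : maximizers_exist P asp v -> exists x, recursive_profile P asp v x.
Proof.
move=> mex.
suff /(_ n.+1 (leqnn _))[x rx] : forall m, (m <= n.+1)%N ->
    exists x, forall i, (i < m)%N -> best_docs P asp v x i (x i).
  by exists x => i; exact: rx.
elim=> [_|m IH mn]; first by exists [ffun=> 0].
have [x rx] := IH (ltnW mn); pose i := Ordinal mn.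
have [y yi] := mex x i rx.
exists (deviate x i y) => i'; rewrite ltnS leq_eqVlt => /orP[i'i|i'i].
  have -> : i' = i by apply/val_inj/eqP.
  by rewrite best_docs_deviate// deviate_id.
by rewrite best_docs_deviate ?(ltnW i'i)// deviate_lt//; exact: rx.
Qed.

(** Strong induction: agreement before [i] makes the argmax sets at [i] equal, and they are
    singletons. *)
Lemma recursive_unique x x' : maximizers_unique P asp v ->
  recursive_profile P asp v x -> recursive_profile P asp v x' -> x = x'.
Proof.
move=> uni rx rx'; apply/ffunP => i.
have [m im] := ubnP i; elim: m i im => // m IH i im.
have [y [_ yuni]] := uni x i (fun i' _ => rx i').
rewrite -(yuni _ (rx i)); apply: yuni.
rewrite (@eq_best_docs x x') // => i' i'i.
by apply: IH; rewrite (leq_trans i'i).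
Qed.

(** The argmax ranges over all of [docs], hence over whatever the other publishers play. *)
Lemma ranking_recursive x m : (m <= n.+1)%N -> is_profile x ->
  (forall i, (i < m)%N -> best_docs P asp v x i (x i)) ->
  take m (ranking (uir_score P asp v) x) = take m (enum 'I_n.+1).
Proof.
move=> mn dx rx; rewrite take_ranking// ranked_prefix// => i im j.
by have [_] := rx _ im; rewrite previous_docsE; apply.
Qed.

Lemma position_recursive_ge x i : is_profile x -> recursive_below P asp v x i ->
  (i <= position (uir_score P asp v) x i)%N.
Proof.
move=> dx rx; rewrite positionE leqNgt; apply/negP => pi.
have : i \in take i (ranking (uir_score P asp v) x) by rewrite in_take ?mem_ranking.
by rewrite ranking_recursive ?(ltnW (ltn_ord i))// -filter_enum_ord_take ?(ltnW (ltn_ord i))//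
  mem_filter ltnn.
Qed.

Lemma position_recursive x i : is_profile x -> recursive_below P asp v x i ->
  best_docs P asp v x i (x i) -> position (uir_score P asp v) x i = i.
Proof.
move=> dx rx bi; rewrite -[in LHS](_ : nth ord0 (ranking (uir_score P asp v) x) i = i).
  by rewrite position_nth.
(* As [x i] is a maximizer too, the prefix of length [i.+1] is in index order. *)
rewrite -(nth_take _ (ltnSn i)) ranking_recursive// ?nth_take ?nth_ord_enum//.
by move=> j; rewrite ltnS leq_eqVlt => /orP[/eqP/val_inj->//|]; exact: rx.
Qed.

(** * Publisher utilities compared with scores *)

Section Utility.
Hypothesis asp_docs : forall a, docs (asp a).
Hypothesis v_unit : unit_valued v.
Hypothesis v_prefix : prefix_dependent v.
Hypothesis v_mono : monotone_utility asp v.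
Hypothesis v_meas : measurable_utility asp v.

Lemma unit_cube_row x a : is_profile x ->
  unit_cube (\row_j sim (x j) (asp a) : 'rV[R]_n.+1).
Proof. by move=> dx j; rewrite mxE; exact: sim_unit. Qed.

Lemma unit_cube_sim_vector L a : (forall y, y \in L -> docs y) ->
  unit_cube (sim_vector asp L a : 'rV[R]_n.+1).
Proof.
move=> dL j; rewrite mxE; have [jL|Lj] := ltnP j (size L).
  by rewrite nth_sim//; apply: sim_unit => //; apply: dL; exact: mem_nth.
(* Missing entries are filled with 0, which lies in the unit interval. *)
by rewrite nth_default ?size_map// lexx ler01.
Qed.

(* Only the documents at positions up to [q] matter, so the score for position [q]
   may be computed with any profile whose first documents are those of [L] and [y]. *)
Lemma uir_score_row (L : seq 'rV[R]_k.+1) y q x : size L = q -> is_profile x ->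
  (forall j : 'I_n.+1, (j < q)%N -> nth 0 L j = x j) -> x q = y ->
  uir_score P asp v y L = 'E_P[fun a => v q (\row_j sim (x j) (asp a))]%E.
Proof.
move=> sL dx xL xq; rewrite /uir_score sL inord_val; congr expectation; apply/funext => a.
have xr (j : 'I_n.+1) : (j <= q)%N -> nth 0 (rcons L y) j = x j.
  rewrite leq_eqVlt nth_rcons sL => /orP[/eqP/val_inj->|jq]; first by rewrite ltnn eqxx xq.
  by rewrite jq xL.
apply: v_prefix => [||j jq]; last 2 first.
- exact: unit_cube_row.
- by rewrite !mxE nth_sim ?size_rcons ?ltnS ?sL// xr.
apply: unit_cube_sim_vector => z /(nthP 0)[j]; rewrite size_rcons sL ltnS => jq <-.
by have := xr (Ordinal (leq_ltn_trans jq (ltn_ord q))) jq => /= ->; exact: dx.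
Qed.

Section ScoreBound.
Variables (f : @score_function R k) (x : profile R n k).
Hypothesis dx : is_profile x.

(** Documents indexed by position: the similarity vectors of [publisher_utility] and
    [monotone_utility] both come from this one profile. *)
Let ranked_profile : profile R n k := [ffun j : 'I_n.+1 => x (nth ord0 (ranking f x) j)].

Lemma sim_vector_ranking a :
  sim_vector asp [seq x i | i <- ranking f x] a = \row_j sim (ranked_profile j) (asp a)
  :> 'rV[R]_n.+1.
Proof.
apply/rowP => j; rewrite !mxE ffunE nth_sim ?size_map ?size_ranking//.
by rewrite (nth_map ord0) ?size_ranking.
Qed.

Lemma ranked_sim_position a :
  ranked_sim asp x (position_perm f x) a = \row_j sim (ranked_profile j) (asp a).
Proof. by apply/rowP => j; rewrite !mxE ffunE position_permV. Qed.

Lemma publisher_utility_row i : publisher_utility P asp v f i x =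
  'E_P[fun a => v (position f x i) (\row_j sim (ranked_profile j) (asp a))]%E.
Proof.
by rewrite /publisher_utility; congr expectation; apply/funext => a; rewrite sim_vector_ranking.
Qed.

Lemma size_take_ranking q : size [seq x i | i <- take q (ranking f x)] = q.
Proof. by rewrite size_map size_take size_ranking ltn_ord. Qed.

Lemma nth_take_ranking q (j : 'I_n.+1) : (j < q)%N ->
  nth 0 [seq x i | i <- take q (ranking f x)] j = ranked_profile j.
Proof.
by move=> jq; rewrite (nth_map ord0) ?nth_take ?ffunE// size_take size_ranking ltn_ord.
Qed.

Lemma ranked_profile_position i : ranked_profile (position f x i) = x i.
Proof. by rewrite ffunE nth_position. Qed.

Lemma utility_eq_score i : publisher_utility P asp v f i x =
  uir_score P asp v (x i) [seq x i' | i' <- take (position f x i) (ranking f x)].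
Proof.
rewrite publisher_utility_row; apply/esym/uir_score_row.
- exact: size_take_ranking.
- by move=> j; rewrite ffunE.
- by move=> j; exact: nth_take_ranking.
- exact: ranked_profile_position.
Qed.

(** Exchanging [i] with the document at the earlier position [q] does not lower its utility, and
    leaves the documents before [q] in place. *)
Lemma utility_le_score i q : (q <= position f x i)%N ->
  (publisher_utility P asp v f i x <=
   uir_score P asp v (x i) [seq x i' | i' <- take q (ranking f x)])%E.
Proof.
rewrite leq_eqVlt => /orP[/eqP/val_inj->|qp]; first by rewrite utility_eq_score.
set p := position f x i in qp *.
pose swapped : profile R n k := [ffun j => ranked_profile (tperm p q j)].
have drk : is_profile ranked_profile by move=> j; rewrite ffunE.
have dsw : is_profile swapped by move=> j; rewrite ffunE.
rewrite (@uir_score_row _ (x i) q swapped)//; last 3 first.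
- exact: size_take_ranking.
- move=> j jq; rewrite nth_take_ranking// [swapped j]ffunE tpermD//.
    by apply: contraTneq jq => <-; rewrite -leqNgt ltnW.
  by apply: contraTneq jq => <-; rewrite ltnn.
- by rewrite ffunE tpermR ranked_profile_position.
rewrite publisher_utility_row; apply: expectation_le.
- exact: v_meas.
- exact: v_meas.
- by move=> a; have /andP[] := v_unit p (unit_cube_row a drk).
- by move=> a; have /andP[] := v_unit q (unit_cube_row a dsw).
apply: aeW => a.
have pq : position_perm f x (nth ord0 (ranking f x) q) = q by rewrite permE position_nth.
have pp : position_perm f x i = p by rewrite permE.
(* Monotonicity is applied aspect by aspect to [i] and the publisher holding position [q]. *)
have := @v_mono x a (position_perm f x) i (nth ord0 (ranking f x) q) dx.
rewrite pq pp ranked_sim_position => /(_ qp) /le_trans; apply.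
rewrite (_ : xcol _ _ _ = \row_j sim (swapped j) (asp a)) //.
by apply/rowP => j; rewrite !mxE [swapped j]ffunE.
Qed.

End ScoreBound.

Lemma utility_le_previous x i : is_profile x -> recursive_below P asp v x i ->
  (publisher_utility P asp v (uir_score P asp v) i x <=
   uir_score P asp v (x i) (previous_docs x i))%E.
Proof.
move=> dx rx; rewrite previous_docsE -(ranking_recursive (ltnW (ltn_ord i)) dx rx).
by apply: utility_le_score => //; exact: position_recursive_ge.
Qed.

Lemma utility_best x i : is_profile x -> recursive_below P asp v x i ->
  best_docs P asp v x i (x i) ->
  publisher_utility P asp v (uir_score P asp v) i x =
  uir_score P asp v (x i) (previous_docs x i).
Proof.
move=> dx rx bi; rewrite utility_eq_score// position_recursive//.
by rewrite ranking_recursive ?(ltnW (ltn_ord i))// previous_docsE.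
Qed.

(** * Equilibria and the recursion *)

Lemma recursive_nash x : recursive_profile P asp v x ->
  nash_equilibrium P asp v (uir_score P asp v) x.
Proof.
move=> rx; have dx := recursive_is_profile rx; split=> // i y dy.
have rxi : recursive_below P asp v x i by move=> i' _; exact: rx.
rewrite (utility_best dx rxi (rx i)).
(* Documents before [i] are untouched by the deviation, so the deviator gets at most the score of
   [y], which is at most that of [x i]. *)
apply: le_trans (utility_le_previous (deviate_profile i dx dy) (deviate_recursive y rxi)) _.
rewrite deviate_id (@eq_previous_docs _ x); last by move=> i'; exact: deviate_lt.
by have [_] := rx i; apply.
Qed.

(* At the first publisher [i] not playing its maximizer [y], the utility is at most the
   score of [x i], while deviating to [y] would secure the maximal score. *)
Lemma nash_recursive x : maximizers_exist P asp v ->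
  nash_equilibrium P asp v (uir_score P asp v) x -> recursive_profile P asp v x.
Proof.
move=> mex [dx nash] i.
have [m im] := ubnP i; elim: m i im => // m IH i im.
have rxi : recursive_below P asp v x i.
  by move=> i' i'i; apply: IH; rewrite (leq_trans i'i).
have [y bi] := mex x i rxi; have [dy ymax] := bi.
split=> // z dz; apply: le_trans (ymax z dz) _.
apply: le_trans (utility_le_previous dx rxi).
have := nash i y dy; rewrite utility_best ?deviate_id; last first.
- by rewrite best_docs_deviate.
- exact: deviate_recursive.
- exact: deviate_profile.
by rewrite (@eq_previous_docs _ x) // => i'; exact: deviate_lt.
Qed.

End Utility.
End Game.

Theorem theorem2 (R : realType) (n k : nat)
    (d : measure_display) (A : measurableType d) (P : probability A R)
    (asp : A -> 'rV[R]_k.+1) (v : user_utility R n)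
    (asp_docs : forall a, docs (asp a))
    (v_unit : unit_valued v)
    (v_prefix : prefix_dependent v)
    (v_mono : monotone_utility asp v)
    (v_meas : measurable_utility asp v) :
  (forall x : profile R n k,
     recursive_profile P asp v x ->
     nash_equilibrium P asp v (uir_score P asp v) x) /\
  (maximizers_exist P asp v ->
     exists x : profile R n k,
       recursive_profile P asp v x /\
       nash_equilibrium P asp v (uir_score P asp v) x) /\
  (maximizers_unique P asp v ->
     exists! x : profile R n k,
       nash_equilibrium P asp v (uir_score P asp v) x).
Proof.
have rec_nash := recursive_nash (P := P) asp_docs v_unit v_prefix v_mono v_meas.
split=> //; split=> [mex|uni].
  by have [x rx] := recursive_exists mex; exists x; split=> //; exact: rec_nash.
have mex : maximizers_exist P asp v.
  by move=> x i /uni[y [yi _]]; exists y.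
have [x rx] := recursive_exists mex.
exists x; split=> [|x' nx']; first exact: rec_nash.
(* Any other equilibrium is itself recursive, so uniqueness reduces to that of recursive
   profiles. *)
by apply: (recursive_unique uni rx); apply: nash_recursive nx'.
Qed.
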